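(* Let $\ell\ge 3$ be a prime and write $\ell-1=2^{\alpha}3^{\beta}m$ for some integers $\alpha,\beta>0$ and $m$ with $\gcd(m,6)=1$. Let $\mathcal{K}_\ell$ denote the set of positive integers $k\le \ell-2$ for which the Demjanenko matrix $D_{k,\ell}$ is singular. If $\ell>441\cdot 2^{4\alpha}\beta^4$, then $\#\mathcal{K}_\ell>0$.
   Context: For a prime $\ell\ge 3$ and $j\in(\mathbb{Z}/\ell\mathbb{Z})^*$, let $\langle j\rangle_\ell$ be the unique integer representative of $j$ modulo $\ell$ in $\{1,\dots,\ell-1\}$. For a positive integer $k\le \ell-2$ define $$M_{k,\ell}:=\{j\in(\mathbb{Z}/\ell\mathbb{Z})^* : \langle kj\rangle_\ell+\langle j\rangle_\ell<\ell\},$$ a set of cardinality $(\ell-1)/2$, and its stabilizer, the subgroup $$W_{k,\ell}:=\{w\in(\mathbb{Z}/\ell\mathbb{Z})^* : wM_{k,\ell}=M_{k,\ell}\}.$$ For $a\in(\mathbb{Z}/\ell\mathbb{Z})^*$ put $E_{k,\ell}(a):=0$ if $a\in M_{k,\ell}$ and $E_{k,\ell}(a):=1$ if $a\notin M_{k,\ell}$. The Demjanenko matrix is the square rational matrix $$D_{k,\ell}:=\left(E_{k,\ell}(-c^{-1}a)-\tfrac12\right)_{c,a\in M_{k,\ell}/W_{k,\ell}},$$ whose rows and columns are indexed by the $W_{k,\ell}$-orbits in $M_{k,\ell}$ (the entry does not depend on the chosen representatives $c,a$). *)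

(* Defs.v *)
From HB Require Import structures.
From mathcomp Require Import all_boot all_order all_algebra all_fingroup.

Set Implicit Arguments.
Unset Strict Implicit.
Unset Printing Implicit Defensive.

Import GRing.Theory.
Local Open Scope group_scope.

(* The group of units of Z/l.  'F_l is Z/l only for prime l, which is the only
   case in which the definitions of this file are meant to be used. *)
Notation Zunits l := {unit 'F_l}.

(* The representative of x in {0, ..., l-1}; it is nonzero whenever x is. *)
Definition zrep (l : nat) (x : 'F_l) : nat := nat_of_ord x.

Definition Mset (k l : nat) : {set Zunits l} :=
  [set j : Zunits l | (zrep (k%:R * val j)%R + zrep (val j) < l)%N].

Definition Wset (k l : nat) : {set Zunits l} :=
  [set w : Zunits l | w *: Mset k l == Mset k l].

Lemma Wset_group_set (k l : nat) : group_set (Wset k l).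
Proof.
apply/group_setP; split; first by rewrite inE mul1g.
move=> x y; rewrite !inE => /eqP Wx /eqP Wy.
by rewrite lcosetM Wy Wx.
Qed.

Canonical Wgroup (k l : nat) : {group Zunits l} := Group (Wset_group_set k l).

Definition Efun (k l : nat) (a : Zunits l) : rat :=
  (if a \in Mset k l then 0 else 1)%R.

Definition opp1u (l : nat) : Zunits l := FinRing.unit 'F_l (unitrN1 'F_l).

Definition demj_entry (k l : nat) (c a : Zunits l) : rat :=
  (Efun k (opp1u l * c^-1 * a)%g - 1 / 2%:R)%R.

(* The set M/W of orbits [W :* j = {w j | w in W}], for j in M. *)
Definition Worbits (k l : nat) : {set {set Zunits l}} :=
  rcosets (Wset k l) (Mset k l).

(* The orbits are numbered by [enum_val], in the same way for the rows and for
   the columns, and [repr] picks an element of an orbit; the choice is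
   irrelevant by [demj_entry_repr] below. *)
Definition Demjanenko (k l : nat) : 'M[rat]_#|Worbits k l| :=
  (\matrix_(i, j) demj_entry k (repr (enum_val i)) (repr (enum_val j)))%R.

Definition singular (n : nat) (A : 'M[rat]_n) : bool := A \notin unitmx.

(* The index type encodes the bound k <= l - 2, i.e. k < l - 1. *)
Definition Kset (l : nat) : {set 'I_l.-1} :=
  [set k : 'I_l.-1 | (0 < k)%N && singular (Demjanenko k l)].

Lemma Efun_Wset (k l : nat) (w x : Zunits l) :
  w \in Wset k l -> Efun k (w * x) = Efun k x.
Proof.
rewrite inE => /eqP Ww; rewrite /Efun.
by rewrite -{1}Ww mem_lcoset mulKg.
Qed.

Lemma demj_entry_repr (k l : nat) (C A : {set Zunits l}) (c a : Zunits l) :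
  C \in Worbits k l -> A \in Worbits k l -> c \in C -> a \in A ->
  demj_entry k (repr C) (repr A) = demj_entry k c a.
Proof.
have comm (x y : Zunits l) : x * y = y * x.
  by apply: val_inj; rewrite /= mulrC.
case/rcosetsP=> x _ -> /rcosetsP[y _ ->] Cc Aa.
have /rcosetP[u Wu ->] := mem_repr c Cc.
have /rcosetP[v Wv ->] := mem_repr a Aa.
have {Cc} /rcosetP[u' Wu' ->] := Cc.
have {Aa} /rcosetP[v' Wv' ->] := Aa.
have E (s t : Zunits l) : s \in Wset k l -> t \in Wset k l ->
  demj_entry k (s * x) (t * y) = demj_entry k x y.
  move=> Ws Wt; rewrite /demj_entry.
  have -> : opp1u l * (s * x)^-1 * (t * y) =
            (s^-1 * t) * (opp1u l * x^-1 * y).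
    by rewrite invMg (comm t y) (comm (s^-1 * t)) -!mulgA (mulgA s^-1 y)
      (comm s^-1 y) -!mulgA.
  by rewrite (@Efun_Wset k l (s^-1 * t)) // groupM ?groupV.
by rewrite !E.
Qed.

(* Main.v *)
Require Import Defs.
From mathcomp Require Import all_boot all_order all_algebra all_fingroup.
From mathcomp Require Import cyclic zify ring lra.

(* Write u = k and v = k+1 in (Z/l)^*, and let H be a subgroup containing u^3
   and -uv but neither u nor -1.  A combination g of the indicator functions of
   H, uH, -H and -uH is then odd and satisfies g(a/u) + g(a) = g(a/v); it plays
   the part of an odd character chi with chi(k) = z and chi(k+1) = -z^2 = 1 + z,
   where z is a primitive cube root of unity.  Pairing the translates of g with
   l E(j) = <kj> + <j> - <(k+1)j> shows that g is in the kernel of D_{k,l},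
   provided that W_{k,l} is trivial.

   W_{k,l} is trivial as soon as k^2 + k + 1 <> 0 mod l: the sum T of the j not
   in M_{k,l} is fixed by multiplication by any element of W_{k,l}, and it is
   nonzero because Voronoi's congruence gives 12 k (k+1) T = k^2 + k + 1 mod l.

   It remains to find k in rH with k+1 in -r^{-1}H and k^2 + k + 1 <> 0, where H
   has index 3 * 2^alpha, r^3 is in H and r is not.  The lines y = a x + b with
   a, b in H all meet rH x (-r^{-1}H) in the same number N of points, namely the
   number of such k without the last condition.  If N <= 2, the variance of the
   number of points on a line, over all lines of the affine plane over F_l,
   forces |H|^4 <= 2 l^3 + 8 l^2, and l is too large for that. *)

Set Implicit Arguments.
Unset Strict Implicit.
Unset Printing Implicit Defensive.

Import Order.TTheory GRing.Theory Num.Theory.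
Local Open Scope ring_scope.

Local Arguments zrep : simpl never.

(** * Lines of the affine plane meeting a product set: second moment *)

Section Incidence.
Variables (F : finFieldType) (A B : {set F}).

Definition line (p : F * F) (x : F) : F := p.1 * x + p.2.

Definition incidence (p : F * F) : nat := #|[set x in A | line p x \in B]|.

Lemma incidenceE (p : F * F) :
  incidence p = (\sum_(x in A) (line p x \in B))%N.
Proof.
rewrite /incidence -sum1_card (eq_bigl (fun x => (x \in A) && (line p x \in B))).
  by rewrite big_mkcondr; apply: eq_bigr => x _; case: (_ \in B).
by move=> x; rewrite inE.
Qed.

Lemma sum_line_hit (x : F) :
  (\sum_(p : F * F) (line p x \in B) = #|F| * #|B|)%N.
Proof.
rewrite -(pair_bigA _ (fun a b => nat_of_bool (line (a, b) x \in B))) /=.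
rewrite -sum_nat_const; apply: eq_bigr => a _.
rewrite (reindex_inj (addrI (- (a * x)))) /=.
under eq_bigr do rewrite /line /= addrA subrr add0r.
by rewrite -big_mkcond sum1_card.
Qed.

(** A line is determined by its values at two distinct abscissae, so [f] permutes the plane and the
    count is that of B x B. *)
Lemma sum_line_hit2 (x y : F) : x != y ->
  (\sum_(p : F * F) (line p x \in B) * (line p y \in B) = #|B| ^ 2)%N.
Proof.
move=> neq_xy; pose f (p : F * F) := (line p x, line p y).
have f_inj : injective f.
  move=> [a b] [a' b'] []; rewrite /line /= => e1 e2.
  have ea : a = a'.
    have /eqP : (a - a') * (x - y) = 0.
      rewrite (_ : _ * _ = (a * x + b - (a' * x + b'))
                           - (a * y + b - (a' * y + b'))); last by ring.
      by rewrite e1 e2 !subrr.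
    by rewrite mulf_eq0 !subr_eq0 (negPf neq_xy) orbF => /eqP.
  by move: e1; rewrite ea => /addrI ->.
rewrite (eq_bigr (fun p => nat_of_bool (f p \in setX B B))); last first.
  by move=> p _; rewrite inE mulnb.
rewrite -big_mkcond sum1_card expnS expn1 -cardsX -(card_preimset _ f_inj).
by apply: eq_card => p; rewrite inE.
Qed.

Lemma sum_incidence : (\sum_p incidence p = #|F| * #|A| * #|B|)%N.
Proof.
under eq_bigr do rewrite incidenceE.
rewrite exchange_big /= (eq_bigr (fun=> #|F| * #|B|)%N).
  by rewrite sum_nat_const mulnCA mulnA.
by move=> x _; apply: sum_line_hit.
Qed.

(** Expand the square over pairs in A x A: [sum_line_hit] counts the diagonal, [sum_line_hit2] the
    rest. The term on the left avoids a subtraction in nat. *)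
Lemma sum_incidence_sqr :
  (\sum_p incidence p ^ 2 + #|A| * #|B| ^ 2 = #|F| * #|A| * #|B| + (#|A| * #|B|) ^ 2)%N.
Proof.
have -> : (\sum_p incidence p ^ 2 = \sum_(x in A) \sum_(y in A)
    (if x == y then #|F| * #|B| else #|B| ^ 2))%N.
  rewrite (eq_bigr (fun p : F * F => \sum_(x in A) \sum_(y in A)
     (line p x \in B) * (line p y \in B))%N); last first.
    by move=> p _; rewrite expnS expn1 incidenceE big_distrlr.
  rewrite exchange_big; apply: eq_bigr => x _; rewrite exchange_big.
  apply: eq_bigr => y _; case: eqP => [<-|/eqP/sum_line_hit2 //].
  by rewrite -(sum_line_hit x); apply: eq_bigr => p _; rewrite mulnb andbb.
have E x : x \in A -> (\sum_(y in A) (if x == y then #|F| * #|B| else #|B| ^ 2) + #|B| ^ 2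
   = #|F| * #|B| + #|A| * #|B| ^ 2)%N.
  move=> Ax; rewrite (bigD1 x) //= eqxx (eq_bigr (fun=> #|B| ^ 2)%N); last first.
    by move=> y /andP[_]; rewrite eq_sym => /negPf->.
  rewrite (cardsD1 x A) Ax mulnDl mul1n -addnA [(_ + #|B| ^ 2)%N]addnC.
  rewrite -sum_nat_const; congr (_ + (_ + _))%N.
  by apply: eq_bigl => y; rewrite !inE andbC.
rewrite -sum_nat_const -big_split /= (eq_bigr _ E) sum_nat_const.
by move: #|A| #|B| #|F| => a b q; lia.
Qed.

(** The mean incidence is |A| |B| / |F|; scaling by |F| keeps everything integral. The two sides
    differ by (|F| |B|)^2 |A|, which is nonnegative. *)
Lemma incidence_variance :
  (\sum_p (#|F|%:R * (incidence p)%:R - (#|A| * #|B|)%:R) ^+ 2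
     <= (#|F| ^ 3 * (#|A| * #|B|))%:R :> int).
Proof.
have s1 := congr1 (fun n => n%:R : int) sum_incidence.
have s2 := congr1 (fun n => n%:R : int) sum_incidence_sqr.
rewrite natr_sum in s1; rewrite natrD natr_sum in s2.
have cF : \sum_(p : F * F) (1 : int) = #|F|%:R ^+ 2.
  by rewrite sumr_const card_prod natrM -expr2.
rewrite (eq_bigr (fun p => #|F|%:R ^+ 2 * (incidence p ^ 2)%:R
    + (- (2 * #|F|%:R * (#|A| * #|B|)%:R) * (incidence p)%:R
       + (#|A| * #|B|)%:R ^+ 2 * 1))); last by move=> p _; rewrite natrX; ring.
rewrite !big_split /= -!mulr_sumr cF s1.
have -> : \sum_p (incidence p ^ 2)%:R = (#|F| * #|A| * #|B| + (#|A| * #|B|) ^ 2)%:R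
   - (#|A| * #|B| ^ 2)%:R :> int by rewrite -s2 addrK.
rewrite -subr_ge0 !(natrM, natrX, natrD).
rewrite (_ : _ - _ = (#|F|%:R * #|B|%:R) ^+ 2 * #|A|%:R); last by ring.
by rewrite mulr_ge0 ?sqr_ge0 ?ler0n.
Qed.
End Incidence.

(** * Cosets of a subgroup of the unit group as point sets *)

Section UnitCosets.
Variables (F : finFieldType) (H : {group {unit F}}).

Definition unit_coset (r : {unit F}) : {set F} := [set val (r * h)%g | h in H].

Lemma unit_mulC (p q : {unit F}) : (p * q = q * p)%g.
Proof. by apply: val_inj; rewrite /= mulrC. Qed.

Lemma unit_neq0 (w : {unit F}) : val w != 0.
Proof. by rewrite -unitfE (valP w). Qed.

Lemma card_unit_coset (r : {unit F}) : #|unit_coset r| = #|H|.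
Proof. by rewrite card_imset // => x y /val_inj /mulgI. Qed.

Lemma unit_coset_scale (r w : {unit F}) (x : F) : w \in H ->
  (val w * x \in unit_coset r) = (x \in unit_coset r).
Proof.
have sub (w' : {unit F}) (y : F) : w' \in H -> y \in unit_coset r ->
   val w' * y \in unit_coset r.
  move=> Hw /imsetP[h Hh ->]; apply/imsetP; exists (h * w')%g; first exact: groupM.
  by rewrite mulgA [RHS]FinRing.val_unitM mulrC.
move=> Hw; apply/idP/idP; last exact: sub.
move=> /(sub (w^-1)%g); rewrite groupV => /(_ Hw).
by rewrite mulrA FinRing.val_unitV mulVf ?mul1r ?unit_neq0.
Qed.

(** Substituting x = (h / a) y turns a x + h into h (y + 1), and multiplication by elements of H
    preserves both cosets. *)
Lemma incidence_unit_coset (r s a h : {unit F}) : a \in H -> h \in H ->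
  incidence (unit_coset r) (unit_coset s) (val a, val h) =
  #|[set x in unit_coset r | x + 1 \in unit_coset s]|.
Proof.
move=> Ha Hh; have Hb : (a^-1 * h)%g \in H by rewrite groupM ?groupV.
rewrite -(card_imset _ (mulfI (unit_neq0 (a^-1 * h)%g))); apply: eq_card => x.
rewrite inE; apply/andP/imsetP => [[Ax Bx]|[y]].
  exists (val (h^-1 * a)%g * x).
    rewrite inE unit_coset_scale ?groupM ?groupV // Ax /=.
    rewrite -(unit_coset_scale _ _ Hh).
    rewrite (_ : _ * _ = line (val a, val h) x) // /line /=.
    by field; rewrite unit_neq0.
  rewrite mulrA -FinRing.val_unitM (_ : (_ * _)%g = 1%g) ?mul1r //.
  by rewrite mulgA mulgK mulVg.
rewrite inE => /andP[Ay By] ->; rewrite unit_coset_scale //; split=> //.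
rewrite -(unit_coset_scale _ _ Hh) in By.
rewrite (_ : line _ _ = val h * (y + 1)) // /line /=.
by field; rewrite unit_neq0.
Qed.

(** The |H|^2 lines with both coefficients in H contribute equally to the variance, whence (|F| N -
    |H|^2)^2 <= |F|^3. The threshold 2 bounds the number of roots of x^2 + x + 1. *)
Lemma few_shifted_coset_points (r s : {unit F}) :
  (#|[set x in unit_coset r | (x + 1)%R \in unit_coset s]| <= 2)%N ->
  (#|H| ^ 4 <= 2 * #|F| ^ 3 + 8 * #|F| ^ 2)%N.
Proof.
set N := #|_| => leN2.
have := incidence_variance (unit_coset r) (unit_coset s).
rewrite !card_unit_coset [X in _ <= X](_ : _ = #|F|%:R ^+ 3 * #|H|%:R ^+ 2); last first.
  by rewrite natrM natrX natrM expr2.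
rewrite natrM -expr2 => var.
pose f (p : {unit F} * {unit F}) := (val p.1, val p.2).
have f_inj : injective f by move=> [a b] [c d] [] /val_inj-> /val_inj->.
have : (#|F|%:R * N%:R - #|H|%:R ^+ 2) ^+ 2 * #|H|%:R ^+ 2
   <= #|F|%:R ^+ 3 * #|H|%:R ^+ 2 :> int.
  apply: le_trans var; rewrite [leRHS](bigID [in f @: setX H H]) /=.
  rewrite big_imset; last by move=> ? ? _ _; apply: f_inj.
  rewrite (eq_bigr (fun=> (#|F|%:R * N%:R - #|H|%:R ^+ 2) ^+ 2)); last first.
    by move=> [a h] /setXP[Ha Hh]; rewrite incidence_unit_coset.
  rewrite sumr_const cardsX -[leRHS]/(_ *+ _ + _).
  rewrite -[_ *+ (_ * _)]mulr_natr natrM -expr2 lerDl.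
  by apply: sumr_ge0 => p _; apply: sqr_ge0.
have : (0 < #|H|)%N by apply: cardG_gt0.
move: #|H| #|F| N leN2 => h q N leN2 h_gt0.
rewrite ler_pM2r ?exprn_gt0 ?ltr0n // => dev.
(* With X = |F| N this is b^2 <= 2 (X - b)^2 + 2 X^2 for b = |H|^2; the difference is (2 X -
   b)^2. *)
have le1 : (h%:R ^+ 2) ^+ 2 <= 2 * (q%:R * N%:R - h%:R ^+ 2) ^+ 2
    + 2 * (q%:R * N%:R) ^+ 2 :> int.
  rewrite -subr_ge0.
  rewrite (_ : _ - _ = (2 * (q%:R * N%:R) - h%:R ^+ 2) ^+ 2); last by ring.
  exact: sqr_ge0.
have le2 : (q%:R * N%:R) ^+ 2 <= (q%:R * 2) ^+ 2 :> int.
  by rewrite -!natrM -!natrX ler_nat leq_exp2r // leq_mul2l leN2 orbT.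
rewrite -(ler_nat int) natrD natrX (natrM _ 2) (natrM _ 8) !natrX; lra.
Qed.
End UnitCosets.

Lemma card_quadratic_roots (F : finFieldType) :
  (#|[set x : F | (x ^+ 2 + x + 1)%R == 0%R]| <= 2)%N.
Proof.
have [->|[x]] := set_0Vmem [set x : F | x ^+ 2 + x + 1 == 0]; first by rewrite cards0.
rewrite inE => /eqP xE.
suff sub : [set x : F | x ^+ 2 + x + 1 == 0] \subset [set x; - x - 1].
  by rewrite (leq_trans (subset_leq_card sub)) // cards2; case: (_ != _).
apply/subsetP => y; rewrite !inE => /eqP yE.
rewrite -subr_eq0 -[_ == - x - 1]subr_eq0 -mulf_eq0.
rewrite (_ : _ * _ = (y ^+ 2 + y + 1) - (x ^+ 2 + x + 1)); last by ring.
by rewrite xE yE subrr.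
Qed.

(** * Least residues modulo l and Voronoi's congruence *)

Section Residues.
Variable l : nat.
Hypothesis l_prime : prime l.
Implicit Types (x y : 'F_l) (j w : Zunits l).

Lemma zrep_lt x : (zrep x < l)%N.
Proof. by rewrite -[X in (_ < X)%N](Fp_cast l_prime) ltn_ord. Qed.

Lemma zrepK x : (zrep x)%:R = x.
Proof. exact: natr_Zp. Qed.

Lemma zrep_nat n : zrep (n%:R : 'F_l) = (n %% l)%N.
Proof. exact: val_Fp_nat. Qed.

Lemma zrep_eq0 x : (zrep x == 0)%N = (x == 0%R).
Proof. by []. Qed.

Lemma zrepD x y : (zrep (x + y)%R + l * (l <= zrep x + zrep y) = zrep x + zrep y)%N.
Proof.
rewrite -{1}[x]zrepK -{1}[y]zrepK -natrD zrep_nat.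
have := zrep_lt x; have := zrep_lt y.
case: (leqP l (zrep x + zrep y)%N) => h hy hx; last first.
  by rewrite modn_small //= muln0 addn0.
have -> : (zrep x + zrep y = (zrep x + zrep y - l) + l)%N by lia.
rewrite modnDr modn_small; lia.
Qed.

Lemma zrepN x : x != 0 -> (zrep (- x)%R + zrep x = l)%N.
Proof.
move=> x0; have := zrepD (- x) x; rewrite addNr.
have := zrep_lt x; have := zrep_lt (- x); have : (0 < zrep x)%N by rewrite lt0n zrep_eq0.
rewrite (_ : zrep (0 : 'F_l) = 0%N) //; case: leqP => ? ? ? ? ; lia.
Qed.

Lemma sum_zrep_sqr : (6 * \sum_(x : 'F_l) zrep x ^ 2 + 3 * l ^ 2 = 2 * l ^ 3 + l)%N.
Proof.
have -> : (\sum_(x : 'F_l) zrep x ^ 2 = \sum_(i < l) i ^ 2)%N.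
  by rewrite -[in RHS](Fp_cast l_prime).
elim: (l) => [|n]; first by rewrite big_ord0.
rewrite big_ord_recr /=; move: (\sum_(i < n) _)%N => S IH; lia.
Qed.

Lemma zrep_floor (a : nat) x :
  (a * zrep x = l * (a * zrep x %/ l) + zrep (a%:R * x)%R)%N.
Proof.
rewrite (_ : a%:R * x = (a * zrep x)%:R); last by rewrite natrM zrepK.
by rewrite zrep_nat {1}(divn_eq (a * zrep x) l) mulnC.
Qed.

(* Voronoi's congruence for the Bernoulli number B_2 = 1/6, by squaring
   [a j = l * floor (a j / l) + (a j mod l)] and summing modulo l^2. *)
Lemma voronoi_congruence (a : nat) : (a%:R : 'F_l) != 0 ->
  12 * a%:R * (\sum_(x : 'F_l) x * (a * zrep x %/ l)%:R) = a%:R ^+ 2 - 1 :> 'F_l.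
Proof.
move=> a0; have l0 : (0 < l)%N := prime_gt0 l_prime.
pose f x := (a * zrep x %/ l)%N.
have e : (\sum_(x : 'F_l) zrep x ^ 2 + 2 * a * l * (\sum_(x : 'F_l) zrep x * f x) =
     a ^ 2 * (\sum_(x : 'F_l) zrep x ^ 2) + l ^ 2 * (\sum_(x : 'F_l) f x ^ 2))%N.
  rewrite [X in (X + _)%N](reindex_inj (mulfI a0)) !big_distrr /=.
  rewrite -!big_split /=.
  apply: eq_bigr => x _; have := zrep_floor a x; rewrite -/(f x).
  move: (zrep _) (zrep x) (f x) => y z g e.
  have -> : (2 * a * l * (z * g) = 2 * l * g * (a * z))%N by lia.
  by rewrite -expnMn e; lia.
have Q := sum_zrep_sqr.
(* Multiply by 6, insert the sum of squares and cancel one factor l; the result can then be reduced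
   modulo l. *)
have {e Q} : (2 * l ^ 2 + 1 + 12 * a * (\sum_(x : 'F_l) zrep x * f x) + 3 * l * a ^ 2 =
      a ^ 2 * (2 * l ^ 2 + 1) + 6 * l * (\sum_(x : 'F_l) f x ^ 2) + 3 * l)%N.
  move: l0 e Q.
  move: (\sum_(x : 'F_l) zrep x ^ 2)%N (\sum_(x : 'F_l) zrep x * f x)%N.
  move: (\sum_(x : 'F_l) f x ^ 2)%N => T Q S l0 e Q6.
  apply/eqP; rewrite -(eqn_pmul2l l0); apply/eqP; nia.
move=> /(congr1 (fun n => n%:R : 'F_l)).
have lF : (l%:R : 'F_l) = 0 by rewrite -(pchar_Fp_0 l_prime).
rewrite !(natrD, natrM, natrX) lF natr_sum => e.
have -> : \sum_(x : 'F_l) x * (f x)%:R = \sum_(x : 'F_l) (zrep x * f x)%:R :> 'F_l.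
  by apply: eq_bigr => x _; rewrite natrM zrepK.
apply/eqP; rewrite eq_sym subr_eq addrC.
move/eqP: e; rewrite !(expr0n, mulr0, mul0r, addr0, add0r) /=.
by rewrite mulr1 eq_sym.
Qed.
End Residues.

(** * The stabilizer W and the kernel of the Demjanenko matrix *)

Section Demjanenko.
Variables (l k : nat) (u v : Zunits l).
Hypotheses (l_prime : prime l) (u_def : val u = k%:R) (v_def : val v = k%:R + 1).
Implicit Types (x : 'F_l) (a b c j w : Zunits l).

Lemma zrep_Mset j :
  (zrep (val (u * j)%g) + zrep (val j) = zrep (val (v * j)%g) + l * (j \notin Mset k l))%N.
Proof.
rewrite inE -leqNgt !FinRing.val_unitM u_def v_def mulrDl mul1r.
by rewrite zrepD.
Qed.

(** Add [zrep_Mset] at j and at -j: opposite residues sum to l, which leaves E(j) + E(-j) = 1. *)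
Lemma Mset_opp j : (opp1u l * j \in Mset k l)%g = (j \notin Mset k l).
Proof.
have opp a : (zrep (val (opp1u l * a)%g) + zrep (val a) = l)%N.
  by rewrite FinRing.val_unitM /= mulN1r zrepN ?unit_neq0.
have := zrep_Mset j; have := zrep_Mset (opp1u l * j)%g.
have l0 := prime_gt0 l_prime.
rewrite !(mulgA _ (opp1u l)) !(unit_mulC _ (opp1u l)) -!mulgA.
have := opp j; have := opp (u * j)%g; have := opp (v * j)%g.
by do 2!case: (_ \in _); rewrite //= ?muln0 ?muln1; lia.
Qed.

Lemma Wset_trivial : k%:R ^+ 2 + k%:R + 1 != 0 :> 'F_l -> Wset k l = 1%g.
Proof.
move=> k_neq; have u0 := unit_neq0 u; have v0 := unit_neq0 v.
rewrite u_def in u0; rewrite v_def natr1 in v0.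
have l0 := prime_gt0 l_prime.
(* On units [e] is E; arithmetically it is the carry when x is added to k x. *)
pose e x := (l <= zrep (k%:R * x)%R + zrep x)%N.
pose T := \sum_(x : 'F_l) x * (e x)%:R.
have eE x : (k.+1 * zrep x %/ l = k * zrep x %/ l + e x)%N.
  apply/eqP; rewrite -(eqn_pmul2l l0); apply/eqP.
  have := zrep_floor l_prime k x; have := zrep_floor l_prime k.+1 x.
  have := zrepD l_prime (k%:R * x) x.
  rewrite (_ : k.+1%:R * x = k%:R * x + x); last by rewrite -natr1 mulrDl mul1r.
  rewrite -/(e x) mulSn.
  move: (k.+1 * zrep x %/ l)%N (k * zrep x)%N => p t.
  move: (t %/ l)%N (nat_of_bool _) => q b.
  by move: (zrep _) (zrep _) (zrep _) => z1 z2 z3; lia.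
have T0 : T != 0.
  (* If T = 0, the congruences for k and k + 1 share the sum S, and eliminating S leaves k^2 + k + 1
     = 0. *)
  apply: contraNneq k_neq => T0.
  have := voronoi_congruence l_prime u0; have := voronoi_congruence l_prime v0.
  rewrite (eq_bigr (fun x => x * (k * zrep x %/ l)%:R + x * (e x)%:R)); last first.
    by move=> x _; rewrite eE natrD mulrDr.
  rewrite big_split /= -/T T0 addr0 -[k.+1%:R]natr1; set S := \sum_x _ => e1 e2.
  rewrite (_ : _ + 1 = k%:R * ((k%:R + 1) ^+ 2 - 1)
                       - (k%:R + 1) * (k%:R ^+ 2 - 1)); last by ring.
  by rewrite -e1 -e2; apply/eqP; ring.
apply/setP=> w; rewrite inE in_set1; apply/eqP/eqP => [Mw|->]; last exact: mul1g.
have ew x : e (val w * x) = e x.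
  have [->|x0] := eqVneq x 0; first by rewrite mulr0.
  have xU : x \is a GRing.unit by rewrite unitfE.
  have eM j : e (val j) = (j \notin Mset k l) by rewrite inE -leqNgt.
  have -> : x = val (FinRing.unit 'F_l xU) by [].
  by rewrite -FinRing.val_unitM !eM -{1}Mw mem_lcoset mulKg.
have : val w * T = T.
  rewrite [in RHS]/T (reindex_inj (mulfI (unit_neq0 w))) /= mulr_sumr.
  by apply: eq_bigr => x _; rewrite ew mulrA.
rewrite -{2}[T]mul1r => /(mulIf T0) w1.
by apply: val_inj.
Qed.

(** Write l E(a) = <ua> + <a> - <va> and move the shifts onto h; the relation between the translates
    of h makes the sum vanish. The constant 1/2 contributes nothing, since an odd h has sum zero. *)
Lemma sum_Efun_odd (h : Zunits l -> rat) :
  (forall a, h (opp1u l * a)%g = - h a) ->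
  (forall a, h (u^-1 * a)%g + h a = h (v^-1 * a)%g) ->
  \sum_a (1 / 2%:R - Efun k a) * h a = 0.
Proof.
move=> h_odd h_uv; pose z a : rat := (zrep (val a))%:R.
have sum_h : \sum_a h a = 0.
  have : \sum_a h a = - \sum_a h a.
    rewrite {1}(reindex_inj (mulgI (opp1u l))) -sumrN.
    by apply: eq_bigr => a _; rewrite h_odd.
  lra.
have shift w : \sum_a z (w * a)%g * h a = \sum_a z a * h (w^-1 * a)%g.
  by rewrite [RHS](reindex_inj (mulgI w)); apply: eq_bigr => a _; rewrite mulKg.
have : l%:R * \sum_a Efun k a * h a = 0.
  rewrite mulr_sumr.
  rewrite (eq_bigr (fun a => z (u * a)%g * h a + (z a * h a - z (v * a)%g * h a))).
    rewrite big_split sumrB /= !shift -sumrB -big_split big1 // => a _ /=.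
    by rewrite -h_uv; ring.
  move=> a _; have := congr1 (fun n => n%:R : rat) (zrep_Mset a).
  rewrite /= !natrD natrM -!/(z _) /Efun => zE.
  rewrite -mulrBl -mulrDl mulrA; congr (_ * _).
  by move: zE; case: (_ \in _) => /=; lra.
move/eqP; rewrite mulf_eq0 pnatr_eq0 -leqn0 leqNgt prime_gt0 //= => /eqP sum_E.
rewrite (eq_bigr (fun a => 1 / 2%:R * h a - Efun k a * h a)); last by move=> a _; ring.
by rewrite sumrB -mulr_sumr sum_h sum_E mulr0 subrr.
Qed.

(** The summand is a product of two odd functions of a, hence even, so its sum over M is half its
    sum over the whole group. Translates of g by c satisfy the same two relations, so [sum_Efun_odd]
    applies. *)
Lemma sum_demj_entry (g : Zunits l -> rat) c :
  (forall a, g (opp1u l * a)%g = - g a) ->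
  (forall a, g (u^-1 * a)%g + g a = g (v^-1 * a)%g) ->
  \sum_(a in Mset k l) demj_entry k c a * g a = 0.
Proof.
move=> g_odd g_uv.
have EN a : Efun k (opp1u l * a) = 1 - Efun k a.
  by rewrite /Efun Mset_opp; case: (_ \in _).
pose phi a := (1 / 2%:R - Efun k (c^-1 * a)%g) * g a.
have demjE a : demj_entry k c a * g a = phi a.
  by rewrite /demj_entry /phi -mulgA EN; congr (_ * _); field.
have phiN a : phi (opp1u l * a)%g = phi a.
  by rewrite /phi g_odd mulgA (unit_mulC _ (opp1u l)) -mulgA EN; field.
have : \sum_a phi a = 0.
  rewrite -[RHS](@sum_Efun_odd (fun a => g (c * a)%g)).
  - rewrite (reindex_inj (mulgI c)); apply: eq_bigr => a _.
    by rewrite /phi mulKg.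
  - by move=> a; rewrite mulgA (unit_mulC c) -mulgA g_odd.
  - move=> a; rewrite !(mulgA c) (unit_mulC c u^-1%g) (unit_mulC c v^-1%g).
    by rewrite -!mulgA g_uv.
have sumC : \sum_(a | a \notin Mset k l) phi a = \sum_(a in Mset k l) phi a.
  rewrite (reindex_inj (mulgI (opp1u l))); apply: eq_big => a; last by rewrite phiN.
  by rewrite Mset_opp negbK.
rewrite (bigID [in Mset k l]) /= sumC (eq_bigr _ (fun a _ => demjE a)); lra.
Qed.

(** When W is trivial the orbits are singletons, so row sums run over M itself and the values of g
    on M form a kernel vector, nonzero at c. *)
Lemma singular_Demjanenko (g : Zunits l -> rat) c :
  Wset k l = 1%g ->
  (forall a, g (opp1u l * a)%g = - g a) ->
  (forall a, g (u^-1 * a)%g + g a = g (v^-1 * a)%g) ->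
  c \in Mset k l -> g c != 0 ->
  singular (Demjanenko k l).
Proof.
move=> W1 g_odd g_uv Mc gc.
have reprW a : repr (rcoset (Wset k l) a) = a.
  by rewrite W1 rcosetE mulg_set1 mul1g repr_set1.
pose y : 'cV[rat]_#|Worbits k l| := \col_i g (repr (enum_val i)).
have Dy : Demjanenko k l *m y = 0.
  apply/colP => i; rewrite !mxE.
  under eq_bigr do rewrite !mxE.
  rewrite -(big_enum_val (fun A => demj_entry k (repr (enum_val i)) (repr A) * g (repr A))).
  rewrite big_imset /=; last by move=> a b _ _ /(congr1 repr); rewrite !reprW.
  under eq_bigr do rewrite reprW.
  exact: sum_demj_entry.
apply/negP => Dunit; have Wc : rcoset (Wset k l) c \in Worbits k l by apply: imset_f.
have y0 : y = 0 by rewrite -(mulKmx Dunit y) Dy mulmx0.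
move/colP/(_ (enum_rank_in Wc (rcoset (Wset k l) c))): y0.
by rewrite !mxE enum_rankK_in // reprW => /eqP; apply/negP.
Qed.
End Demjanenko.

(** * The odd function built from cosets of H *)

Ltac unit_field :=
  by apply: val_inj;
     rewrite !(FinRing.val_unitM, FinRing.val_unitV, FinRing.val_unitX) /=;
     field; rewrite ?expf_neq0 ?unit_neq0 ?oppr_eq0 ?oner_eq0.

Lemma singular_of_cosets (l k : nat) (H : {group Zunits l}) (u v : Zunits l) :
  prime l -> val u = k%:R -> val v = k%:R + 1 -> (k.+1 < l)%N ->
  k%:R ^+ 2 + k%:R + 1 != 0 :> 'F_l ->
  (u ^+ 3 \in H)%g -> u \notin H -> opp1u l \notin H ->
  (opp1u l * u * v \in H)%g ->
  singular (Demjanenko k l).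
Proof.
move=> l_prime u_def v_def lt_k k_neq Hu3 Hu Hopp Huv.
set e := opp1u l in Hopp Huv *.
have ee : (e * e = 1)%g by apply: val_inj; rewrite FinRing.val_unitM /= mulrNN mulr1.
pose I (a : Zunits l) : rat := (a \in H)%:R.
have IH a b : (a * b^-1)%g \in H -> I a = I b.
  by move=> Hab; rewrite /I -[a](mulgKV b) groupMl.
pose g a := I a - I (u^-1 * a)%g - I (e * a)%g + I (e * u^-1 * a)%g.
apply: (@singular_Demjanenko l k u v l_prime u_def v_def g 1%g).
- exact: Wset_trivial u_def v_def _.
- move=> a; rewrite /g -/e.
  rewrite (_ : (e * (e * a) = a)%g); last by rewrite mulgA ee mul1g.
  rewrite (_ : (e * u^-1 * (e * a) = u^-1 * a)%g); last first.
    by rewrite (unit_mulC e) -!mulgA (mulgA e) ee mul1g.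
  rewrite (mulgA _ e) (unit_mulC _ e); ring.
(* Modulo H, u^-2 is u and v^-1 is -u; these two rules reduce both sides to the values of I at a,
   ua, -a, -ua and their like. *)
- have Iu a : I (u^-1 * (u^-1 * a))%g = I (u * a)%g.
    apply: IH; rewrite [X in X \in H](_ : _ = (u ^+ 3)^-1)%g ?groupV //; unit_field.
  have Iv a : I (v^-1 * a)%g = I (e * u * a)%g.
    apply: IH; rewrite [X in X \in H](_ : _ = (e * u * v)^-1)%g ?groupV //; unit_field.
  move=> a; rewrite /g.
  rewrite (_ : (u^-1 * (v^-1 * a) = v^-1 * (u^-1 * a))%g); last by unit_field.
  rewrite (_ : (e * (v^-1 * a) = v^-1 * (e * a))%g); last by unit_field.
  rewrite (_ : (e * u^-1 * (v^-1 * a) = v^-1 * (e * u^-1 * a))%g); last by unit_field.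
  rewrite (_ : (e * u^-1 * (u^-1 * a) = u^-1 * (u^-1 * (e * a)))%g); last by unit_field.
  rewrite !Iv !Iu.
  rewrite (_ : (e * u * (u^-1 * a) = e * a)%g); last by unit_field.
  rewrite (_ : (e * u * (e * a) = u * a)%g); last by unit_field.
  rewrite (_ : (e * u * (e * u^-1 * a) = a)%g); last by unit_field.
  rewrite (_ : (u * (e * a) = e * u * a)%g); last by unit_field.
  rewrite (_ : (e * (u^-1 * a) = e * u^-1 * a)%g); last by unit_field.
  ring.
(* 1 lies in M because <k> + <1> = k + 1 < l. *)
- by rewrite inE mulr1 zrep_nat // (zrep_nat l_prime 1) !modn_small ?addn1 //; lia.
(* g(1) = 1 + I(-1/u), since neither 1/u nor -1 is in H. *)
- have I0 : 0 <= I (e * u^-1)%g by rewrite ler0n.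
  apply: lt0r_neq0; rewrite /g !mulg1 /I group1 groupV (negPf Hu) (negPf Hopp) -/(I _).
  by rewrite /= !subr0 ltr_wpDr ?ltr01.
Qed.

(** * Numerical estimate and choice of k *)

Lemma coset_index_bound (l p d : nat) :
  (441 <= l)%N -> (l - 1 = 3 * p * d)%N -> (441 * p ^ 4 < l)%N ->
  (2 * l ^ 3 + 8 * l ^ 2 < d ^ 4)%N.
Proof.
move=> l_ge l_eq p_lt; rewrite ltnNge; apply/negP => d_le.
have [r rE] : exists r, l = r.+1 by exists l.-1; lia.
rewrite {}rE subn1 /= in l_ge l_eq p_lt d_le.
(* Here r = l - 1, and d^4 = r^4 / (81 p^4) exceeds about 5.4 l^3, since 441 / 81 > 5.4. In [h2] the
   ratio l / r is bounded by 11/10; in [h3], 648 = 81 * 8 and l >= 324. *)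
have r4 : (r ^ 4 = 81 * (p ^ 4 * d ^ 4))%N by rewrite l_eq !expnMn -mulnA.
have h1 : (441 * r ^ 4 <= 81 * (r.+1 * (2 * r.+1 ^ 3 + 8 * r.+1 ^ 2)))%N.
  rewrite r4 mulnCA leq_mul2l /= mulnA; apply: leq_mul => //; exact: ltnW.
have h2 : (10 ^ 4 * r.+1 ^ 4 <= 11 ^ 4 * r ^ 4)%N.
  by rewrite -!expnMn leq_exp2r //; lia.
have h3 : (648 * r.+1 ^ 3 <= 2 * r.+1 ^ 4)%N.
  by rewrite (expnS _ 3) mulnA leq_mul2r; apply/orP; right; lia.
have r0 : (0 < r ^ 4)%N by rewrite expn_gt0; lia.
have h4 : (r.+1 * (2 * r.+1 ^ 3 + 8 * r.+1 ^ 2) = 2 * r.+1 ^ 4 + 8 * r.+1 ^ 3)%N.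
  by move: (r.+1) => s; rewrite mulnDr mulnCA -expnS mulnCA -expnS.
move: h1 h2 h3 r0; rewrite h4; move: (r.+1 ^ 4)%N (r.+1 ^ 3)%N (r ^ 4)%N => x y z; lia.
Qed.

Lemma exists_shifted_coset_point (F : finFieldType) (H : {group {unit F}})
    (r s : {unit F}) :
  (2 * #|F| ^ 3 + 8 * #|F| ^ 2 < #|H| ^ 4)%N ->
  exists2 x, (x \in unit_coset H r) && (x + 1 \in unit_coset H s) & x ^+ 2 + x + 1 != 0.
Proof.
move=> H_large; case: (pickP [pred x | (x \in unit_coset H r)
    && (x + 1 \in unit_coset H s) & x ^+ 2 + x + 1 != 0]) => [x /andP[]|none].
  by exists x.
move: H_large; rewrite ltnNge => /negP[]; apply: (@few_shifted_coset_points _ _ r s).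
apply: leq_trans (card_quadratic_roots F); apply: subset_leq_card.
by apply/subsetP => x; rewrite !inE => xP; have := none x; rewrite /= xP => /negbFE.
Qed.

Theorem corollary2 (l alpha beta m : nat)
  (l_prime : prime l) (l_ge3 : (3 <= l)%N)
  (alpha_gt0 : (0 < alpha)%N) (beta_gt0 : (0 < beta)%N)
  (m_coprime6 : gcdn m 6 = 1%N)
  (l_decomp : (l - 1 = 2 ^ alpha * 3 ^ beta * m)%N)
  (l_large : (441 * 2 ^ (4 * alpha) * beta ^ 4 < l)%N) :
  (0 < #|Kset l|)%N.
Proof.
pose p := (2 ^ alpha)%N; pose d := (3 ^ beta.-1 * m)%N.
have p_gt0 : (0 < p)%N by rewrite expn_gt0.
have l_eq : (l - 1 = 3 * p * d)%N.
  by rewrite l_decomp -(prednK beta_gt0) expnS /p /d; nia.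
have d_gt0 : (0 < d)%N by rewrite lt0n; apply/eqP => d0; move: l_eq; rewrite d0; lia.
(* Odd order will keep -1 out of H, as (-1)^d = -1. *)
have d_odd : odd d.
  rewrite oddM oddX /= orbT /=.
  have : coprime m 6 by rewrite /coprime m_coprime6.
  by rewrite (coprimeMr _ 2 3) coprimen2 => /andP[].
have p_lt : (441 * p ^ 4 < l)%N.
  apply: leq_ltn_trans l_large; rewrite /p -expnM mulnC (mulnC alpha) mulnC.
  by rewrite leq_pmulr // expn_gt0 beta_gt0.
have l_ge : (441 <= l)%N.
  by apply: leq_trans (ltnW p_lt); rewrite leq_pmulr // expn_gt0 p_gt0.
have /cyclicP[c cE] := field_unit_group_cyclic [set: Zunits l]%G.
have oc : #[c]%g = (3 * p * d)%N.
  by rewrite /order -cE card_finField_unit card_Fp // -l_eq subn1.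
(* H is the subgroup of order d; r has order 3 d, so it lies outside H, while its cube generates
   H. *)
pose H := <[c ^+ (3 * p)]>%G; pose r := (c ^+ p)%g.
have cardH : #|H| = d.
  rewrite -orderE orderXdiv oc; first by rewrite mulKn // muln_gt0 p_gt0.
  exact: dvdn_mulr.
have or : #[r]%g = (3 * d)%N.
  rewrite orderXdiv oc -mulnA mulnCA; first by rewrite mulKn.
  exact: dvdn_mulr.
have Hr : r \notin H.
  by apply/negP => /order_dvdG; rewrite or cardH => /(dvdn_leq d_gt0); lia.
have Hopp : opp1u l \notin H.
  apply/negP => /expg_cardG/(congr1 val); rewrite cardH FinRing.val_unitX /=.
  rewrite -signr_odd d_odd expr1 => /eqP.
  rewrite eq_sym -subr_eq0 opprK -(natrD _ 1 1) -(dvdn_pcharf (pchar_Fp l_prime)).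
  by rewrite gtnNdvd.
have H_large : (2 * #|'F_l| ^ 3 + 8 * #|'F_l| ^ 2 < #|H| ^ 4)%N.
  by rewrite cardH card_Fp //; exact: coset_index_bound l_ge l_eq p_lt.
have [x] := exists_shifted_coset_point r (opp1u l * r^-1)%g H_large.
case/andP=> /imsetP[h Hh xE] /imsetP[h' Hh' x1E] x_neq.
pose k := zrep x; have kx : k%:R = x by apply: zrepK.
(* k = l - 1 is excluded because x + 1 is a unit. *)
have lt_k : (k < l.-1)%N.
  have := zrep_lt l_prime x; rewrite -/k => lt_kl.
  have : k.+1 != l.
    apply: contra_neq (unit_neq0 (opp1u l * r^-1 * h')%g) => kl.
    by rewrite -x1E -kx natr1 kl (pcharf0 (pchar_Fp l_prime)).
  by move: l_ge; lia.
apply/card_gt0P; exists (Ordinal lt_k); rewrite inE /=; apply/andP; split.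
  by rewrite lt0n zrep_eq0 xE unit_neq0.
apply: (@singular_of_cosets l k H (r * h)%g (opp1u l * r^-1 * h')%g) => //; rewrite ?kx //.
- lia.
- rewrite (_ : ((r * h) ^+ 3 = c ^+ (3 * p) * h ^+ 3)%g).
    by rewrite groupM ?cycle_id ?(groupX _ Hh).
  by rewrite expgMn; [rewrite /r -expgM mulnC|exact: unit_mulC].
- by rewrite groupMr.
- rewrite [X in X \in H](_ : _ = h * h')%g ?groupM //; unit_field.
Qed.
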